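(* Let $d$ be a positive integer, $(\mathcal{M}, D)$ a metric space, $r > 0$ and $\gamma$ a real number. Let $F : \{0,1\}^d \to \mathcal{M}$ and $G : \{0,1\}^d \to \mathcal{M}$ be maps such that for all $S, T \in \{0,1\}^d$: if $\mathsf{DISJ}(S,T) = 1$ then $D(F(S), G(T)) \le r$, and if $\mathsf{DISJ}(S,T) = 0$ then $D(F(S), G(T)) \ge \gamma r$. Then $\gamma \le 3$.
   Context: For $S, T \in \{0,1\}^d$, $\mathsf{DISJ}(S,T) = 1$ if there is no coordinate $j$ with $S_j = T_j = 1$ (i.e., the supports are disjoint), and $\mathsf{DISJ}(S,T) = 0$ otherwise. *)

(* Defs.v *)
From mathcomp Require Import all_boot.

Set Implicit Arguments.
Unset Strict Implicit.
Unset Printing Implicit Defensive.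

Definition DISJ (d : nat) (S T : {ffun 'I_d -> bool}) : bool :=
  ~~ [exists j : 'I_d, S j && T j].

(* Main.v *)
Require Import Defs.
From mathcomp Require Import all_boot all_order all_algebra.
From mathcomp Require Import reals metric_structure.

Import Order.TTheory GRing.Theory Num.Theory.

Local Open Scope ring_scope.

(** The zero vector is disjoint from everything, so [F 0] and [G 0] act as hubs: [F 1] and [G 1] are
    joined through them by three short hops, although the all-ones vector meets itself. The triangle
    inequality gives [gamma * r <= 3 * r], and [r > 0] cancels. *)

Lemma DISJ0l (d : nat) (T : {ffun 'I_d -> bool}) : DISJ [ffun=> false] T.
Proof. by apply/existsP => -[j]; rewrite ffunE. Qed.

Lemma DISJ0r (d : nat) (S : {ffun 'I_d -> bool}) : DISJ S [ffun=> false].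
Proof. by apply/existsP => -[j]; rewrite ffunE andbF. Qed.

(** Positivity of [d] supplies coordinate 0 as a common point of the supports. *)
Lemma DISJ11 (d : nat) (d_gt0 : (0 < d)%N) :
  DISJ [ffun _ : 'I_d => true] [ffun=> true] = false.
Proof.
by apply/negbTE/negPn/existsP; exists (Ordinal d_gt0); rewrite !ffunE.
Qed.

Theorem theorem3p9 (R : realType) (d : nat) (d_gt0 : (0 < d)%N)
    (M : metricType R) (r : R) (r_gt0 : 0 < r) (gamma : R)
    (F G : {ffun 'I_d -> bool} -> M)
    (FG_disj : forall S T : {ffun 'I_d -> bool},
        DISJ S T = true -> mdist (F S) (G T) <= r)
    (FG_ndisj : forall S T : {ffun 'I_d -> bool},
        DISJ S T = false -> gamma * r <= mdist (F S) (G T)) :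
  gamma <= 3.
Proof.
(* The path F(1) - G(0) - F(0) - G(1) has three edges of length at most r,
   while DISJ(1, 1) = 0. *)
pose zero : {ffun 'I_d -> bool} := [ffun=> false].
pose one : {ffun 'I_d -> bool} := [ffun=> true].
rewrite -(ler_pM2r r_gt0); apply: le_trans (FG_ndisj one one (DISJ11 d d_gt0)) _.
apply: le_trans (metric_triangle _ (G zero) _) _.
rewrite (_ : 3 * r = r + (r + r)); last by rewrite mulr_natl !mulrS addr0.
apply: lerD; first exact/FG_disj/DISJ0r.
apply: le_trans (metric_triangle _ (F zero) _) _.
(* The middle hop runs from [G] to [F], so symmetry is needed before [FG_disj] applies. *)
by apply: lerD; [rewrite metric_sym; exact/FG_disj/DISJ0l | exact/FG_disj/DISJ0l].
Qed.
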